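(* If $M$ is a compact length space then $$\min L(M)\le \mathrm{minind}(M)\,\mathrm{diam}(M).$$
   Context: A compact length space is a compact metric space in which every pair of points is joined by a length minimizing rectifiable curve whose length equals the distance between the points; $\mathrm{diam}(M)$ is the diameter of $M$. $S^1=\mathbb{R}/2\pi\mathbb{Z}$. A closed geodesic in $M$ is a nonconstant map $\gamma:S^1\to M$ that is locally length minimizing around every point of $S^1$, parametrized proportionally to arclength with speed $L(\gamma)/(2\pi)$, where $L(\gamma)$ is its length. The length spectrum $L(M)$ is the set of lengths of closed geodesics in $M$, so $\min L(M)$ is the length of the shortest closed geodesic. A $1/k$ geodesic is a closed geodesic $\gamma$ which is minimizing on all subsegments of length $L(\gamma)/k$, that is, $d(\gamma(t),\gamma(t+2\pi/k))=L(\gamma)/k$ for all $t\in S^1$. The minimizing index $\mathrm{minind}(\gamma)$ of a closed geodesic $\gamma$ is the smallest $k\in\mathbb{N}$ such that $\gamma$ is a $1/k$ geodesic. The minimizing index $\mathrm{minind}(M)$ of $M$ is the smallest $k$ such that there is a closed geodesic in $M$ of minimizing index $k$. *)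

(* Defs.v *)
From HB Require Import structures.
From mathcomp Require Export all_boot all_order all_algebra.
From mathcomp Require Export all_classical all_reals all_analysis.

Set Implicit Arguments.
Unset Strict Implicit.
Unset Printing Implicit Defensive.

Import Order.TTheory GRing.Theory Num.Theory.
Import numFieldNormedType.Exports.

Local Open Scope classical_set_scope.
Local Open Scope ring_scope.

(** Polygonal length of [c] along the partition [a < s_0 < ... < s_n = b];
    metric analogue of [variation] for real functions. *)
Definition polygonal_length (R : realType) (M : metricType R)
    (a b : R) (c : R -> M) (s : seq R) : R :=
  let x := nth b (a :: s) in
  \sum_(0 <= i < size s) mdist (c (x i)) (c (x i.+1)).

(** Length of [c] restricted to [[a, b]], meant for [a <= b] (for [b < a] there
    is no partition and the value is [-oo]). The value is [+oo] when [c] is not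
    rectifiable on [[a, b]]. *)
Definition curve_length (R : realType) (M : metricType R)
    (a b : R) (c : R -> M) : \bar R :=
  ereal_sup [set (polygonal_length a b c s)%:E | s in itv_partition a b].

(** The right-hand side is finite, so a minimizing curve is rectifiable. *)
Definition minimizing_on (R : realType) (M : metricType R)
    (a b : R) (c : R -> M) : Prop :=
  curve_length a b c = (mdist (c a) (c b))%:E.

Definition length_space (R : realType) (M : metricType R) : Prop :=
  forall x y : M, exists c : R -> M,
    [/\ {within `[0, 1], continuous c}, c 0 = x, c 1 = y & minimizing_on 0 1 c].

Definition diam (R : realType) (M : metricType R) : \bar R :=
  ereal_sup [set (mdist p.1 p.2)%:E | p in [set: M * M]].

(** Maps from the circle [R / 2 pi Z] are encoded as [2 pi]-periodic maps on [R]. *)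
Definition periodic2pi (R : realType) (M : metricType R) (g : R -> M) : Prop :=
  forall t : R, g (t + 2 * pi) = g t.

Definition loop_length (R : realType) (M : metricType R) (g : R -> M) : \bar R :=
  curve_length 0 (2 * pi) g.

Definition closed_geodesic (R : realType) (M : metricType R) (g : R -> M) : Prop :=
  [/\ periodic2pi g,
      continuous g,
      exists s t : R, g s <> g t,
      forall t : R, exists2 e : R, 0 < e & minimizing_on (t - e) (t + e) g
    & loop_length g \is a fin_num /\
      forall a b : R, a <= b ->
        curve_length a b g = (fine (loop_length g) / (2 * pi) * (b - a))%:E].

Definition length_spectrum (R : realType) (M : metricType R) : set (\bar R) :=
  [set loop_length g | g in @closed_geodesic R M].

(** [0 < k] is needed: since [x / 0 = 0], the last condition would hold
    trivially for [k = 0]. *)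
Definition geodesic_1over (R : realType) (M : metricType R)
    (k : nat) (g : R -> M) : Prop :=
  [/\ (0 < k)%N, closed_geodesic g
    & forall t : R,
        mdist (g t) (g (t + 2 * pi / k%:R)) = fine (loop_length g) / k%:R].

(** Smallest element of a set of natural numbers, [+oo] if it is empty. *)
Definition smallest (R : realType) (P : set nat) : \bar R :=
  ereal_inf [set k%:R%:E | k in P].
Arguments smallest : clear implicits.

Definition minind_geodesic (R : realType) (M : metricType R)
    (g : R -> M) : \bar R :=
  smallest R [set k : nat | geodesic_1over k g].

Definition minind (R : realType) (M : metricType R) : \bar R :=
  smallest R [set k : nat | exists2 g : R -> M,
    closed_geodesic g & minind_geodesic g = k%:R%:E].

(* Main.v *)
Require Import Defs.
Import Order.TTheory GRing.Theory Num.Theory.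
Import numFieldNormedType.Exports.
Local Open Scope classical_set_scope.
Local Open Scope ring_scope.

(** Let [g] realize the minimizing index [k] of the space. Since [g] is a [1/k]
    geodesic, the points [g 0] and [g (2 pi / k)] are at distance [L(g) / k],
    which is at most the diameter; hence [L(g) <= k diam M], and the infimum of
    the length spectrum is at most [L(g)].

    What has to be checked is that the indices are attained, so that such a [g]
    exists: the infimum of a nonempty set of natural numbers belongs to the set
    ([smallest_attained]), and this is used once for the index of the space and
    once for the index of [g]. If no closed geodesic has a finite index, the
    index of the space is [+oo]; the diameter is positive because a closed
    geodesic is nonconstant, so the right-hand side is [+oo]. *)

(** Well-ordering of the natural numbers, seen through the infimum in the
    extended reals. *)
Lemma smallest_attained (R : realType) {P : set nat} :
  P !=set0 -> exists2 k, P k & smallest R P = k%:R%:E.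
Proof.
move=> [n Pn].
have exP : exists m, `[< P m >] by exists n; apply/asboolP.
have [k /asboolP Pk kmin] := ex_minnP exP.
exists k => //; apply/eqP; rewrite eq_le; apply/andP; split.
  by apply: ereal_inf_lbound; exists k.
apply: le_ereal_inf_tmp => _ [m Pm <-].
by rewrite lee_fin ler_nat; apply: kmin; apply/asboolP.
Qed.

Lemma smallest_set0 (R : realType) : smallest R set0 = +oo%E.
Proof. by rewrite /smallest image_set0 ereal_inf0. Qed.

Lemma smallest_natP {R : realType} {P : set nat} {k : nat} :
  smallest R P = k%:R%:E -> P k.
Proof.
have [->|/set0P/(smallest_attained R)[m Pm ->]] := eqVneq P set0.
  by rewrite smallest_set0.
by move=> [] /eqP; rewrite eqr_nat => /eqP <-.
Qed.

Lemma le_mdist_diam {R : realType} {M : metricType R} (x y : M) :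
  ((mdist x y)%:E <= diam M)%E.
Proof. by apply: ereal_sup_ubound; exists (x, y). Qed.

Lemma diam_gt0 {R : realType} {M : metricType R} {x y : M} :
  x <> y -> (0 < diam M)%E.
Proof.
move=> /eqP xy; apply: lt_le_trans (le_mdist_diam x y).
by rewrite lte_fin mdist_gt0.
Qed.

(** A [1/k] geodesic is cut into [k] minimizing arcs of equal length, each no
    longer than the diameter. *)
Lemma loop_length_le_diam {R : realType} {M : metricType R}
    {k : nat} {g : R -> M} :
  geodesic_1over k g -> (loop_length g <= k%:R%:E * diam M)%E.
Proof.
move=> [k_gt0 [_ _ _ _ [finL _]] distL].
have kR_gt0 : 0 < k%:R :> R by rewrite ltr0n.
have -> : loop_length g = (k%:R%:E * (fine (loop_length g) / k%:R)%:E)%E.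
  by rewrite -EFinM mulrC divfK ?gt_eqF // fineK.
by rewrite lee_pmul2l // -(distL 0) le_mdist_diam.
Qed.

Theorem theorem6p1 (R : realType) (M : metricType R)
    (Mcompact : compact [set: M]) (Mlength : length_space M)
    (Mgeodesic : length_spectrum M !=set0) :
  (ereal_inf (length_spectrum M) <= minind M * diam M)%E.
Proof.
rewrite /minind; set P := (X in smallest R X).
have [P0|/set0P/(smallest_attained R)[k [g geo_g ind_g] ->]] := eqVneq P set0.
  have [_ [g [_ _ [s [t gst]] _ _] _]] := Mgeodesic.
  by rewrite P0 smallest_set0 gt0_mulye ?leey // (diam_gt0 gst).
apply: le_trans (loop_length_le_diam (smallest_natP ind_g)).
by apply: ereal_inf_lbound; exists g.
Qed.
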